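(* Let $X$ be a nonempty compact metric space and let $\phi$ be the semiflow of an impulsive dynamical system $(X,\varphi,D,I)$. If $I(\Omega_\phi\cap D)\subset\Omega_\phi\setminus D$, then $\phi_t(\Omega_\phi\setminus D)\subset\Omega_\phi\setminus D$ for all $t\ge0$.
   Context: A semiflow on a metric space $X$ is a map $\phi:\mathbb{R}^+_0\times X\to X$, $\phi_t(x)=\phi(t,x)$, with $\phi_0(x)=x$ and $\phi_{t+s}(x)=\phi_t(\phi_s(x))$ for all $x\in X$, $s,t\ge 0$ (not necessarily continuous). Non-wandering set: $x\in X$ is non-wandering for $\phi$ if for every neighborhood $U$ of $x$ and any $T>0$ there exists $t\ge T$ with $\phi_t^{-1}(U)\cap U\ne\emptyset$; $\Omega_\phi$ denotes the set of all non-wandering points. Impulsive dynamical system: let $\varphi:\mathbb{R}^+_0\times X\to X$ be a continuous semiflow, $D\subset X$ a compact set and $I:D\to X$ a continuous function. Put $\tau_1(x)=\inf\{t>0:\varphi_t(x)\in D\}$ if $\varphi_t(x)\in D$ for some $t>0$, and $\tau_1(x)=+\infty$ otherwise. Assume $\tau_1(x)>0$ for all $x\in X$. The impulsive trajectory $\gamma_x$ and impulsive times $\tau_n(x)$ of $x$ are defined by: $\gamma_x(t)=\varphi_t(x)$ for $0\le t<\tau_1(x)$; if $\tau_1(x)<\infty$, then $\gamma_x(\tau_1(x))=I(\varphi_{\tau_1(x)}(x))$; inductively, as long as $\tau_n(x)<\infty$, $\tau_{n+1}(x)=\tau_n(x)+\tau_1(\gamma_x(\tau_n(x)))$, $\gamma_x(t)=\varphi_{t-\tau_n(x)}(\gamma_x(\tau_n(x)))$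 for $\tau_n(x)<t<\tau_{n+1}(x)$, and, if $\tau_{n+1}(x)<\infty$, $\gamma_x(\tau_{n+1}(x))=I(\varphi_{\tau_{n+1}(x)-\tau_n(x)}(\gamma_x(\tau_n(x))))$. Put $T(x)=\sup_{n\ge1}\tau_n(x)$ (the supremum over all impulsive times that are defined). The tuple $(X,\varphi,D,I)$ is an impulsive dynamical system if $\tau_1(x)>0$ and $T(x)=+\infty$ for all $x\in X$. Its (impulsive) semiflow is $\phi:\mathbb{R}^+_0\times X\to X$, $\phi(t,x)=\gamma_x(t)$; it is a semiflow, not necessarily continuous. *)

(* Defs.v *)
From mathcomp Require Import all_boot all_order all_algebra.
From mathcomp Require Import all_classical all_reals.
From mathcomp Require Import ereal topology.

Set Implicit Arguments.
Unset Strict Implicit.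
Unset Printing Implicit Defensive.

Import Order.TTheory GRing.Theory Num.Theory.
Import numFieldTopology.Exports.

Local Open Scope classical_set_scope.
Local Open Scope ring_scope.

(* Time ranges over the nonnegative reals: a map on [0, +oo[ * X is represented
   by a function R -> X -> X whose values at negative times are irrelevant. *)

Section Semiflow.
Context {R : realType} {X : metricType R}.
Implicit Type phi : R -> X -> X.

Definition semiflow phi : Prop :=
  (forall x, phi 0 x = x) /\
  (forall s t x, 0 <= s -> 0 <= t -> phi (t + s) x = phi t (phi s x)).

Definition continuous_semiflow phi : Prop :=
  semiflow phi /\
  {within [set p : R * X | 0 <= p.1], continuous (fun p => phi p.1 p.2)}.

Definition nonwandering phi (x : X) : Prop :=
  forall U : set X, nbhs x U -> forall T : R, 0 < T ->
  exists2 t, T <= t & (phi t @^-1` U) `&` U !=set0.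

Definition nonwandering_set phi : set X := [set x | nonwandering phi x].

End Semiflow.

Section ImpulsiveSystem.
Context {R : realType} {X : metricType R}.
(* The impulse function D -> X is represented by a total function I; it is only
   ever evaluated at points of D (the infimum defining a finite first_hit is
   attained when D is closed, varphi is continuous and first_hit is positive). *)
Variables (varphi : R -> X -> X) (D : set X) (I : X -> X).

(* Equal to +oo when the trajectory of x never meets D at a positive time,
   since ereal_inf set0 = +oo. *)
Definition first_hit (x : X) : \bar R :=
  ereal_inf [set t%:E | t in [set t : R | 0 < t /\ D (varphi t x)]].

(* The point at which the impulsive trajectory of x restarts after n impulses;
   meaningless if fewer than n impulses occur. *)
Fixpoint impulse_point (n : nat) (x : X) : X :=
  if n is m.+1 then
    let y := impulse_point m x in I (varphi (fine (first_hit y)) y)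
  else x.

(* The n-th impulsive time for n >= 1, with the convention that time 0 is 0.
   Once one of these times is +oo, so are all the following ones (which
   are those left undefined by the usual recursion). *)
Fixpoint impulse_time (n : nat) (x : X) : \bar R :=
  if n is m.+1 then
    (impulse_time m x + first_hit (impulse_point m x))%E
  else 0%E.

Definition impulse_sup (x : X) : \bar R :=
  ereal_sup [set impulse_time n x | n in [set n | (1 <= n)%N]].

Record impulsive_system : Prop := ImpulsiveSystem {
  impulsive_flow : continuous_semiflow varphi ;
  impulsive_set_compact : compact D ;
  impulsive_fun_continuous : {within D, continuous I} ;
  first_hit_gt0 : forall x, (0 < first_hit x)%E ;
  impulse_sup_pinfty : forall x, impulse_sup x = +oo%E
}.

(* The number of impulses undergone by x up to and including time t; in an
   impulsive system there is exactly one such n for every t >= 0. *)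
Definition impulse_index (t : R) (x : X) : nat :=
  get [set n | (impulse_time n x <= t%:E)%E /\
               (t%:E < impulse_time n.+1 x)%E].

(* At an impulsive time the value is varphi 0 (impulse_point n x), that is
   impulse_point n x itself, the image under I of the point of D reached. *)
Definition impulsive_semiflow (t : R) (x : X) : X :=
  let n := impulse_index t x in
  varphi (t - fine (impulse_time n x)) (impulse_point n x).

End ImpulsiveSystem.

(* Main.v *)
Require Import Defs.
From mathcomp Require Import all_boot all_order all_algebra.
From mathcomp Require Import all_classical all_reals.
From mathcomp Require Import ereal topology normedtype lra.

Set Implicit Arguments.
Unset Strict Implicit.
Unset Printing Implicit Defensive.

Import Order.TTheory GRing.Theory Num.Theory.
Import numFieldTopology.Exports.

Local Open Scope classical_set_scope.
Local Open Scope ring_scope.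

(** Write Omega for the non-wandering set of the impulsive semiflow phi, and
    let x be in Omega, outside D.

    Until the orbit of x first meets D, phi follows the continuous flow. By
    compactness of the time segment [0, t], an orbit that starts off D and
    avoids D up to time t has neighbours that do the same
    ([near_first_hit_gt]), so phi t is continuous at x when t < first_hit x.
    Hence phi t carries the returns of points near x to returns of points near
    phi t x: this uses that phi s and phi t commute, i.e. the semigroup law
    [impulsive_semiflowD]. So the orbit stays in Omega until the first hit
    ([nonwandering_before_hit]), and since Omega is closed, the point p of D
    that is reached belongs to Omega ([nonwandering_at_hit]). The hypothesis on
    I then says that I p is again in Omega, outside D, and the argument starts
    afresh from I p.

    Both this iteration and the semigroup law are instances of an induction over
    impulses, [impulsive_ind]: finitely many impulses occur before any given
    time. *)

(** * Non-wandering points *)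

(** Being non-wandering is a condition on neighbourhoods, and an open
    neighbourhood of a limit of non-wandering points is a neighbourhood of one
    of them. *)
Lemma closed_nonwandering_set (R : realType) (X : metricType R)
    (phi : R -> X -> X) : closed (nonwandering_set phi).
Proof.
move=> x clx U /nbhs_interior Ux T T0.
have [y [yN Uy]] := clx _ Ux.
by have [t tT [z [Uz Uz']]] := yN _ Uy T T0; exists t => //; exists z.
Qed.

(** * Continuous semiflows *)

Section ContinuousSemiflow.
Context {R : realType} {X : metricType R} (varphi : R -> X -> X).
Hypothesis cflow : continuous_semiflow varphi.

Lemma near_flow t x U : 0 <= t -> nbhs (varphi t x) U ->
  \forall s \near t & y \near x, 0 <= s -> U (varphi s y).
Proof.
move=> t0 UN; have [_ /subspace_continuousP c] := cflow.
exact: (c (t, x) t0 U UN).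
Qed.

(** Used twice: with A := D, the infimum defining a hitting time is attained;
    with A := Omega, the point where the orbit hits D is non-wandering. *)
Lemma closed_flow (A : set X) r x : closed A -> 0 <= r ->
  (forall e, 0 < e -> exists t, [/\ 0 <= t, `|r - t| < e & A (varphi t x)]) ->
  A (varphi r x).
Proof.
move=> clA r0 h; apply: clA => U /(near_flow r0).
move=> [[/= V W] [/nbhs_ballP[e /= e0 Ve] /nbhs_singleton Wx] VWU].
have [t [t0 rt At]] := h _ e0; exists (varphi t x); split=> //.
by apply: (VWU (t, x)) => //; split=> //; exact: Ve.
Qed.

End ContinuousSemiflow.

(** * The first hitting time of a closed set *)

Section FirstHit.
Context {R : realType} {X : metricType R}.
Variables (varphi : R -> X -> X) (D : set X).
Hypothesis cflow : continuous_semiflow varphi.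
Hypothesis hit_gt0 : forall x, (0 < first_hit varphi D x)%E.
Local Notation first_hit := (first_hit varphi D).

Lemma first_hit_le t x : 0 < t -> D (varphi t x) -> (first_hit x <= t%:E)%E.
Proof. by move=> t0 Dt; apply: ereal_inf_lbound; exists t. Qed.

Lemma first_hit_attained r x : closed D -> first_hit x = r%:E ->
  0 < r /\ D (varphi r x).
Proof.
move=> clD hr; have r0 : 0 < r by rewrite -lte_fin -hr.
split=> //; apply: (closed_flow cflow clD) (ltW r0) _.
move=> e e0; have : (first_hit x < (r + e)%:E)%E by rewrite hr lte_fin ltrDl.
move=> /ereal_inf_lt [_ [t [t0 Dt] <-]]; rewrite lte_fin => tre.
exists t; split=> //; first exact: ltW.
have := first_hit_le t0 Dt; rewrite hr lee_fin => rt.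
by rewrite distrC ger0_norm; lra.
Qed.

(** The times at which the orbit of x meets D are all later than s, and those
    of varphi s x are their translates by - s. *)
Lemma first_hit_flow s x : 0 <= s -> (s%:E < first_hit x)%E ->
  first_hit x = (s%:E + first_hit (varphi s x))%E.
Proof.
have [[_ flowD] _] := cflow.
move=> s0 sx; apply/eqP; rewrite eq_le; apply/andP; split.
  rewrite -leeBlDl//; apply: le_ereal_inf_tmp => _ [t [t0 Dt] <-].
  rewrite leeBlDl// -EFinD addrC; apply: first_hit_le; first lra.
  by rewrite flowD // ltW.
apply: le_ereal_inf_tmp => _ [t [t0 Dt] <-].
have := lt_le_trans sx (first_hit_le t0 Dt); rewrite lte_fin => st.
rewrite -leeBrDl// -EFinB; apply: first_hit_le; first by rewrite subr_gt0.
by rewrite -flowD ?subrK// subr_ge0 ltW.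
Qed.

(** The first hitting time is lower semicontinuous off D. The starting point
    has to be off D: a point of D may return to D late while nearby points hit D
    almost at once. *)
Lemma near_first_hit_gt t x : closed D -> ~ D x -> 0 <= t ->
  (t%:E < first_hit x)%E -> \forall y \near x, (t%:E < first_hit y)%E.
Proof.
move=> clD Dx t0 tx; have [[flow0 _] _] := cflow.
have avoid : \forall y \near x,
    `[0, t] `<=` [set s | 0 <= s -> ~ D (varphi s y)].
  move/compact_near_coveringP: (@segment_compact R 0 t); apply=> s /=.
  rewrite in_itv /= => /andP[s0 st].
  apply: (@near_flow _ _ _ cflow s x (~` D) s0).
  apply: open_nbhs_nbhs; split; first exact: closed_openC.
  move: s0; rewrite le_eqVlt => /predU1P[<-|s0]; first by rewrite /= flow0.
  move=> /= /(first_hit_le s0) sx.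
  by have := lt_le_trans tx sx; rewrite lte_fin ltNge st.
apply: filterS avoid => y yD.
(* Avoiding D on [0, t] gives the strict inequality because the infimum, if
   finite, is itself a hitting time. *)
rewrite ltNge; apply/negP => yt.
have yfin : first_hit y \is a fin_num.
  by rewrite ge0_fin_numE ?(ltW (hit_gt0 _))// (le_lt_trans yt)// ltry.
have [r0 Dr] := first_hit_attained clD (esym (fineK yfin)).
apply: (yD (fine (first_hit y))) Dr; last exact: ltW.
by rewrite /= in_itv /= ltW//= -lee_fin fineK.
Qed.

End FirstHit.

(** * The impulsive semiflow *)

Section ImpulsiveSemiflow.
Context {R : realType} {X : metricType R}.
Variables (varphi : R -> X -> X) (D : set X) (I : X -> X).
Hypothesis sys : impulsive_system varphi D I.
Local Notation first_hit := (first_hit varphi D).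
Local Notation impulse_time := (impulse_time varphi D I).
Local Notation impulse_point := (impulse_point varphi D I).
Local Notation phi := (impulsive_semiflow varphi D I).

Let cflow := impulsive_flow sys.
Let hit_gt0 := first_hit_gt0 sys.

Lemma impulsive_set_closed : closed D.
Proof.
apply: compact_closed (impulsive_set_compact sys); exact: metric_hausdorff.
Qed.

(** [impulse_point] and [impulse_time] add impulses at the end of the orbit;
    this lemma and the next one peel off the first impulse instead, as inductions
    along the orbit require. *)
Lemma impulse_pointS r x n : first_hit x = r%:E ->
  impulse_point n.+1 x = impulse_point n (I (varphi r x)).
Proof. by move=> hr; elim: n => [|n IH] /=; [rewrite hr | rewrite -IH]. Qed.

Lemma impulse_timeS r x n : first_hit x = r%:E ->
  impulse_time n.+1 x = (r%:E + impulse_time n (I (varphi r x)))%E.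
Proof.
move=> hr; elim: n => [|n IH]; first by rewrite /= hr add0e adde0.
rewrite -[LHS]/(impulse_time n.+1 x + first_hit (impulse_point n.+1 x))%E.
by rewrite IH (impulse_pointS n hr) -addeA.
Qed.

Lemma impulse_time_ge0 n x : (0 <= impulse_time n x)%E.
Proof. by elim: n => //= n IH; rewrite adde_ge0// ltW. Qed.

Lemma impulse_time_homo m n x : (m <= n)%N ->
  (impulse_time m x <= impulse_time n x)%E.
Proof.
elim: n => [|n IH]; first by rewrite leqn0 => /eqP->.
rewrite leq_eqVlt => /predU1P[->//|/IH mn].
by apply: (le_trans mn); rewrite leeDl// ltW.
Qed.

(** Induction over the impulses that x undergoes up to time t: there are finitely
    many of them because the impulsive times of x are unbounded. *)
Lemma impulsive_ind (P : R -> X -> Prop) :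
  (forall t x, 0 <= t -> (t%:E < first_hit x)%E -> P t x) ->
  (forall r t x, first_hit x = r%:E -> r <= t ->
     P (t - r) (I (varphi r x)) -> P t x) ->
  forall t x, 0 <= t -> P t x.
Proof.
move=> P0 PS t x t0.
have [n tn] : exists n, (t%:E < impulse_time n x)%E.
  have : (t%:E < impulse_sup varphi D I x)%E.
    by rewrite (impulse_sup_pinfty sys) ltry.
  by move=> /ereal_sup_gt[_ [n _ <-]]; exists n.
elim: n t x t0 tn => [|n IH] t x t0.
  by rewrite [impulse_time _ _]/= lte_fin ltNge t0.
have [tx _|xt tn] := ltP t%:E (first_hit x); first exact: P0.
have hr : first_hit x = (fine (first_hit x))%:E.
  by rewrite fineK// ge0_fin_numE ?(ltW (hit_gt0 _))// (le_lt_trans xt)// ltry.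
have rt : fine (first_hit x) <= t by rewrite -lee_fin -hr.
apply: (PS _ _ _ hr rt); apply: IH; first by rewrite subr_ge0.
by rewrite EFinB lteBlDl// -impulse_timeS.
Qed.

(** The impulsive times do not decrease, so at most one index brackets t, and
    the choice made by [impulse_index] is forced. *)
Lemma impulse_indexP n t x :
  (impulse_time n x <= t%:E)%E -> (t%:E < impulse_time n.+1 x)%E ->
  impulse_index varphi D I t x = n.
Proof.
move=> nt tn; apply: get_unique; first by split.
move=> m [mt tm]; apply/eqP; rewrite eqn_leq.
apply/andP; split; rewrite leqNgt; apply/negP => /(impulse_time_homo x) h.
  by have := lt_le_trans (lt_le_trans tn h) mt; rewrite ltxx.
by have := lt_le_trans (lt_le_trans tm h) nt; rewrite ltxx.
Qed.

Lemma impulsive_semiflow_lt t x : 0 <= t -> (t%:E < first_hit x)%E ->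
  phi t x = varphi t x.
Proof.
move=> t0 tx; rewrite /impulsive_semiflow (@impulse_indexP 0) ?subr0//=.
by rewrite add0e.
Qed.

Lemma impulse_index_ex t x : 0 <= t -> exists n,
  (impulse_time n x <= t%:E)%E /\ (t%:E < impulse_time n.+1 x)%E.
Proof.
move: t x; apply: impulsive_ind => [t x t0 tx|r t x hr rt [n [nt tn]]].
  by exists 0%N; split=> //=; rewrite add0e.
exists n.+1; rewrite !(impulse_timeS _ hr).
by rewrite -leeBrDl// -lteBlDl// -EFinB.
Qed.

Lemma impulsive_semiflow_ge r t x : first_hit x = r%:E -> r <= t ->
  phi t x = phi (t - r) (I (varphi r x)).
Proof.
move=> hr rt.
have [|n [nt tn]] := @impulse_index_ex (t - r) (I (varphi r x)).
  by rewrite subr_ge0.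
have nt' : (impulse_time n.+1 x <= t%:E)%E.
  by rewrite (impulse_timeS _ hr) -leeBrDl// -EFinB.
have tn' : (t%:E < impulse_time n.+2 x)%E.
  by rewrite (impulse_timeS _ hr) -lteBlDl// -EFinB.
rewrite /impulsive_semiflow (impulse_indexP nt tn) (impulse_indexP nt' tn').
rewrite (impulse_timeS _ hr) (impulse_pointS _ hr) fineD//=; last first.
  by rewrite ge0_fin_numE ?impulse_time_ge0// (le_lt_trans nt)// ltry.
by congr varphi; lra.
Qed.

(** By induction on the impulses that x undergoes up to time s. An impulse before
    s is removed from both sides. If there is none, then varphi s x has the first
    impulse of x, at a time shifted by s, and the two orbits meet there. *)
Lemma impulsive_semiflowD s t x : 0 <= s -> 0 <= t ->
  phi (t + s) x = phi t (phi s x).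
Proof.
move=> + t0; move: s x.
have [[_ flowD] _] := cflow.
apply: impulsive_ind => [s x s0 sx|r s x hr rs IH]; last first.
  rewrite (impulsive_semiflow_ge hr rs) -IH.
  by rewrite (impulsive_semiflow_ge hr) ?addrA//; lra.
have xE := first_hit_flow cflow s0 sx.
rewrite (impulsive_semiflow_lt s0 sx).
have [ty|] := ltP t%:E (first_hit (varphi s x)).
  rewrite (impulsive_semiflow_lt t0 ty) -flowD//.
  apply: impulsive_semiflow_lt; first by rewrite addr_ge0.
  by rewrite xE addrC EFinD lteD2lE.
have := hit_gt0 (varphi s x).
case hy : (first_hit (varphi s x)) => [r| |]//; rewrite lte_fin lee_fin => r0 rt.
rewrite hy -EFinD in xE.
rewrite (impulsive_semiflow_ge hy rt) (impulsive_semiflow_ge xE); last lra.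
rewrite [s + r]addrC flowD ?(ltW r0)//; congr impulsive_semiflow; lra.
Qed.

(** V, the preimage of U under phi t, is a neighbourhood of x although phi t need
    not be continuous elsewhere. If z and phi s z are both in V, then phi t z and
    phi s (phi t z) = phi t (phi s z) are both in U. *)
Lemma nonwandering_before_hit t x : 0 <= t -> ~ D x ->
  (t%:E < first_hit x)%E -> nonwandering phi x ->
  nonwandering phi (varphi t x).
Proof.
move=> t0 Dx tx xN U UN T T0.
pose V := [set y | U (phi t y)].
have VN : nbhs x V.
  have [[/= A B] [/nbhs_singleton At Bx] ABU] := near_flow cflow t0 UN.
  have := near_first_hit_gt cflow hit_gt0 impulsive_set_closed Dx t0 tx.
  apply: filterS2 Bx => y By ty; rewrite /V /= impulsive_semiflow_lt//.
  by apply: (ABU (t, y)).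
have [s Ts [z [Vsz Vz]]] := xN _ VN _ T0.
have s0 : 0 <= s by lra.
exists s => //; exists (phi t z); split=> //=.
by rewrite -impulsive_semiflowD// addrC impulsive_semiflowD.
Qed.

(** The hit point is the limit of the continuous orbit at earlier times, which
    lies in the closed non-wandering set. *)
Lemma nonwandering_at_hit r x : ~ D x -> first_hit x = r%:E ->
  nonwandering phi x -> nonwandering phi (varphi r x).
Proof.
move=> Dx hr xN.
have [r0 _] := first_hit_attained cflow hit_gt0 impulsive_set_closed hr.
apply: (closed_flow cflow (@closed_nonwandering_set _ _ phi)) (ltW r0) _ => e e0.
(* The maximum keeps the chosen time nonnegative when e is large. *)
exists (Num.max 0 (r - e / 2)).
have ge0 : 0 <= Num.max 0 (r - e / 2) by rewrite le_max lexx.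
have ltr : Num.max 0 (r - e / 2) < r by rewrite gt_max r0/=; lra.
split=> //; last by apply: nonwandering_before_hit => //; rewrite hr lte_fin.
have : r - e / 2 <= Num.max 0 (r - e / 2) by rewrite le_max lexx orbT.
by rewrite ger0_norm; lra.
Qed.

End ImpulsiveSemiflow.

Theorem theorem2 (R : realType) (X : metricType R)
    (varphi : R -> X -> X) (D : set X) (I : X -> X) (phi : R -> X -> X) :
  [set: X] !=set0 ->
  compact [set: X] ->
  impulsive_system varphi D I ->
  phi = impulsive_semiflow varphi D I ->
  I @` (nonwandering_set phi `&` D) `<=` nonwandering_set phi `\` D ->
  forall t : R, 0 <= t ->
    phi t @` (nonwandering_set phi `\` D) `<=` nonwandering_set phi `\` D.
Proof.
move=> _ _ sys -> ID t t0 _ [x xN <-].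
have cflow := impulsive_flow sys; have hit_gt0 := first_hit_gt0 sys.
move: t x t0 xN; apply: (impulsive_ind sys) => [t x t0 tx|r t x hr rt IH] [xN Dx].
  rewrite (impulsive_semiflow_lt sys)//.
  split; first exact: (nonwandering_before_hit sys).
  move: t0 tx; rewrite le_eqVlt => /predU1P[<- _|t0 tx].
    by have [[-> _] _] := cflow.
  by move=> /(@first_hit_le _ _ varphi D _ _ t0); rewrite leNgt tx.
rewrite (impulsive_semiflow_ge sys hr rt); apply: IH; apply: ID.
have [_ Dp] := first_hit_attained cflow hit_gt0 (impulsive_set_closed sys) hr.
by exists (varphi r x) => //; split=> //; exact: (nonwandering_at_hit sys).
Qed.
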